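(* Let $U_7^{13}=\{L(C)\in TLeib_7 : c_{2,3}=c_{1,2}=0,\ c_{1,1}\neq 0,\ c_{1,4}\neq 0\}$. 1. Two algebras $L(C)$ and $L(C')$ from $U_7^{13}$ are isomorphic if and only if $$\left(\frac{c'_{1,4}}{c'_{1,1}}\right)^8\left(4c'_{0,0}c'_{1,1}-{c'}_{0,1}^{2}\right)=\left(\frac{c_{1,4}}{c_{1,1}}\right)^8\left(4c_{0,0}c_{1,1}-c_{0,1}^2\right)\quad\text{and}\quad \frac{c'_{1,1}c'_{1,3}}{{c'}_{1,4}^{2}}=\frac{c_{1,1}c_{1,3}}{c_{1,4}^2}.$$ 2. For any $\lambda_1,\lambda_2\in\mathbb{C}$ there exists $L(C)\in U_7^{13}$ with $\left(\frac{c_{1,4}}{c_{1,1}}\right)^8(4c_{0,0}c_{1,1}-c_{0,1}^2)=\lambda_1$ and $\frac{c_{1,1}c_{1,3}}{c_{1,4}^2}=\lambda_2$. Moreover, the orbits (isomorphism classes) in $U_7^{13}$ are parameterized by the algebras $L(\lambda_1,0,1,0,\lambda_2,1,0)$, $\lambda_1,\lambda_2\in\mathbb{C}$: these algebras lie in $U_7^{13}$ and every algebra in $U_7^{13}$ is isomorphic to one of them.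
   Context: All algebras are over $\mathbb{C}$. For $C=(c_{0,0},c_{0,1},c_{1,1},c_{1,2},c_{1,3},c_{1,4},c_{2,3})\in\mathbb{C}^7$, $L(C)$ denotes the $7$-dimensional complex (Leibniz) algebra with basis $e_0,e_1,\dots,e_6$ and products (products of basis vectors not listed are zero): $[e_i,e_0]=e_{i+1}$ for $1\le i\le 5$; $[e_0,e_i]=-e_{i+1}$ for $2\le i\le 5$; $[e_0,e_0]=c_{0,0}e_6$; $[e_0,e_1]=-e_2+c_{0,1}e_6$; $[e_1,e_1]=c_{1,1}e_6$; $[e_1,e_2]=-[e_2,e_1]=c_{1,2}e_4+c_{1,3}e_5+c_{1,4}e_6$; $[e_1,e_3]=-[e_3,e_1]=c_{1,2}e_5+c_{1,3}e_6$; $[e_1,e_4]=-[e_4,e_1]=(c_{1,2}-c_{2,3})e_6$; $[e_2,e_3]=-[e_3,e_2]=c_{2,3}e_6$. $TLeib_7$ is the set of all $L(C)$, $C\in\mathbb{C}^7$. The entries of $C'$ are denoted $c'_{i,j}$, in the same order. ''Isomorphic'' means isomorphic as algebras over $\mathbb{C}$; an orbit is an isomorphism class. *)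

(* Defs.v *)
From HB Require Import structures.
From mathcomp Require Import all_boot all_order all_algebra.
From mathcomp Require Import sesquilinear complex reals ring.

Set Implicit Arguments.
Unset Strict Implicit.
Unset Printing Implicit Defensive.

Import GRing.Theory.
Local Open Scope ring_scope.

(* An algebra, not assumed associative or unital, is given by its product. *)
Definition isomorphic (K : fieldType) (V W : lmodType K)
    (m : {bilinear V -> V -> V}) (n : {bilinear W -> W -> W}) : Prop :=
  exists f : {linear V -> W}, bijective f /\ {morph f : x y / m x y >-> n x y}.

Definition right_leibniz (K : fieldType) (V : lmodType K)
    (m : {bilinear V -> V -> V}) : Prop :=
  forall x y z, m x (m y z) = m (m x y) z - m (m x z) y.

Record params (K : Type) := Params
  { c00 : K; c01 : K; c11 : K; c12 : K; c13 : K; c14 : K; c23 : K }.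

Section TLeib7.
Variable K : fieldType.
Implicit Types (C : params K) (x y : 'rV[K]_7).

Definition e (i : nat) : 'rV[K]_7 := delta_mx 0 (inord i).

(* The product of e i and e j; only i, j < 7 is meaningful. *)
Definition table C (i j : nat) : 'rV[K]_7 :=
  match i, j with
  | 0, 0 => (c00 C *: e 6)%R
  | 0, 1 => (- e 2 + c01 C *: e 6)%R
  | 0, (2 | 3 | 4 | 5) => (- e j.+1)%R
  | (1 | 2 | 3 | 4 | 5), 0 => (e i.+1)%R
  | 1, 1 => (c11 C *: e 6)%R
  | 1, 2 => (c12 C *: e 4 + c13 C *: e 5 + c14 C *: e 6)%R
  | 2, 1 => (- (c12 C *: e 4 + c13 C *: e 5 + c14 C *: e 6))%R
  | 1, 3 => (c12 C *: e 5 + c13 C *: e 6)%R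
  | 3, 1 => (- (c12 C *: e 5 + c13 C *: e 6))%R
  | 1, 4 => ((c12 C - c23 C) *: e 6)%R
  | 4, 1 => (- ((c12 C - c23 C) *: e 6))%R
  | 2, 3 => (c23 C *: e 6)%R
  | 3, 2 => (- (c23 C *: e 6))%R
  | _, _ => 0%R
  end%N.

Definition L C x y : 'rV[K]_7 :=
  \sum_(i < 7) \sum_(j < 7) (x 0 i * y 0 j) *: table C i j.

Fact L_bilinear C : bilinear_for *:%R *:%R (L C).
Proof.
split=> u a v w /=; rewrite /L scaler_sumr -big_split; apply: eq_bigr => i _;
  rewrite scaler_sumr -big_split; apply: eq_bigr => j _ /=;
  rewrite !mxE scalerA -scalerDl; congr (_ *: _); ring.
Qed.

HB.instance Definition _ C := bilinear_isBilinear.Build K _ _ _ _ _ (L C)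
  (L_bilinear C).

Lemma L_basis C i j : (i < 7)%N -> (j < 7)%N -> L C (e i) (e j) = table C i j.
Proof.
move=> li lj; rewrite /L (bigD1 (inord i)) //= (bigD1 (inord j)) //=.
rewrite !mxE !eqxx mulr1 scale1r !inordK // big1 ?addr0 => [|k nk]; last first.
  by rewrite !mxE (negPf nk) mulr0 scale0r.
rewrite big1 ?addr0 // => k nk; rewrite big1 // => l _.
by rewrite !mxE (negPf nk) mul0r scale0r.
Qed.

Lemma L_coord C x y : L C x y = \row_(k < 7)
  let a i := x 0 (inord i) in let b i := y 0 (inord i) in
  let w i j := a i * b j - a j * b i in
  [:: 0; 0; w 1 0; w 2 0; w 3 0 + c12 C * w 1 2;
      w 4 0 + c13 C * w 1 2 + c12 C * w 1 3;
      w 5 0 + c00 C * (a 0 * b 0) + c01 C * (a 0 * b 1) + c11 C * (a 1 * b 1)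
        + c14 C * w 1 2 + c13 C * w 1 3
        + (c12 C - c23 C) * w 1 4 + c23 C * w 2 3]`_k.
Proof.
have eE i (k : 'I_7) : (i < 7)%N -> e i 0 k = (val k == i)%:R.
  by move=> li; rewrite mxE eqxx -val_eqE /= inordK.
have -> : L C x y = \sum_(i < 7) \sum_(j < 7)
    (x 0 (inord i) * y 0 (inord j)) *: table C i j.
  by apply: eq_bigr => i _; apply: eq_bigr => j _; rewrite !inord_val.
apply/rowP => k; rewrite summxE mxE.
under eq_bigr do rewrite summxE.
under eq_bigr do under eq_bigr do rewrite mxE.
do 7 rewrite ?big_ord_recl /=.
rewrite !big_ord0 /bump /= !add1n !(eE, mxE) //.
by case: k => [[|[|[|[|[|[|[|k]]]]]]] lk] //=; ring.
Qed.

Lemma L_leibniz C : right_leibniz (L C).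
Proof.
move=> x y z; rewrite /= !L_coord; apply/rowP => k; rewrite !mxE /= !mxE !inordK //=.
by case: k => [[|[|[|[|[|[|[|k]]]]]]] lk] //=; ring.
Qed.

Definition U13 C : Prop :=
  [/\ c23 C = 0, c12 C = 0, c11 C != 0 & c14 C != 0].

End TLeib7.

(* Main.v *)
Require Import Defs.
From mathcomp Require Import all_boot all_order all_algebra.
From mathcomp Require Import complex reals.
From mathcomp Require Import ring.
Import GRing.Theory Num.Theory.
Local Open Scope ring_scope.

(** Let c_12 = c_23 = c'_12 = c'_23 = 0, and let f : L(C) -> L(C') be an
    isomorphism.  Write a and s for the coordinates of f e_0 on e_0 and e_1, and
    b for that of f e_1 on e_1.  Right multiplication by e_0 moves e_i to
    e_(i+1), so f is triangular from e_2 on, with diagonal entries a^(i-1) b,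
    once one knows that f e_1 has no component on e_0.  This last fact comes
    from [e_2, e_1], which lies in the span of e_5 and e_6 although
    [e_2, e_0] = e_3.

    Comparing the products that involve structure constants gives the five
    equations [matches].  Those for c_00, c_01, c_11 say how the quadratic form
    q with [x, x] = q(x) e_6 on the span of e_0 and e_1 transforms under the
    substitution e_0 -> a e_0 + s e_1, e_1 -> b e_1, given that f multiplies
    e_6 by a^5 b; those for c_13 and c_14 are mere rescalings, the possible
    correction to c_14 cancelling against the coordinate of f e_5 on e_6.
    Conversely, any solution (a, b, s) with a and b nonzero comes from an
    isomorphism with e_0 -> a e_0 + s e_1 and e_1 -> b e_1.  These are
    [matches_of_isomorphic] and [isomorphic_of_matches].

    What remains is the action of (a, b, s) on the coefficients.  Passing from
    C to C' multiplies the discriminant of q by a^8 and divides c_14 / c_11 by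
    a, whence the first invariant; it multiplies c_11 c_13 and c_14^2 by the
    same factor, whence the second.  Conversely a is read off c_14 / c_11, then
    b off c_11, then s off c_01 (for which 2 must be invertible); the equality
    of the two invariants yields the equations for c_13 and c_00.  The family in
    the last part meets every class exactly once because its members have
    invariants 4 l1 and l2. *)

Local Notation crd x k := (x 0 (inord k)).

Section Classification.
Variable K : fieldType.
Implicit Types (C : params K) (x y : 'rV[K]_7).

(** * Coordinates and the filtration by the spans of e_k, ..., e_6 *)

Lemma rV7P x y : (forall k, (k < 7)%N -> crd x k = crd y k) -> x = y.
Proof. by move=> exy; apply/rowP => k; rewrite -(inord_val k) exy. Qed.

Lemma L_crd C x y k : (k < 7)%N ->
  crd (L C x y) k =
  let a i := crd x i in let b i := crd y i in
  let w i j := a i * b j - a j * b i in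
  [:: 0; 0; w 1%N 0%N; w 2%N 0%N; w 3%N 0%N + c12 C * w 1%N 2%N;
      w 4%N 0%N + c13 C * w 1%N 2%N + c12 C * w 1%N 3%N;
      w 5%N 0%N + c00 C * (a 0%N * b 0%N) + c01 C * (a 0%N * b 1%N)
        + c11 C * (a 1%N * b 1%N) + c14 C * w 1%N 2%N + c13 C * w 1%N 3%N
        + (c12 C - c23 C) * w 1%N 4%N + c23 C * w 2%N 3%N]`_k.
Proof. by move=> lk; rewrite L_coord mxE inordK. Qed.

(** For k > 1 the vectors with this property form a term of the lower central
    series. *)
Definition below (k : nat) (x : 'rV[K]_7) := forall i, (i < k)%N -> crd x i = 0.

(** On the graded pieces of the filtration only right multiplication by e_0
    acts: this forces the triangular shape of isomorphisms. *)
Lemma L_below C k x y : (1 < k < 6)%N -> below k x ->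
  below k.+1 (L C x y) /\ crd (L C x y) k.+1 = crd x k * crd y 0.
Proof.
move=> lk x0; split=> [i li|].
  rewrite L_crd //=; last first.
    by case/andP: lk => _ lk; apply: leq_trans li (leqW lk).
  case: k i lk x0 li => [|[|[|[|[|[|k]]]]]] // [|[|[|[|[|[|i]]]]]] //= _ x0 _;
    rewrite ?x0 //; ring.
rewrite L_crd //=; last by case/andP: lk.
case: k lk x0 => [|[|[|[|[|[|k]]]]]] //= _ x0; rewrite (x0 0) // ?(x0 1) //;
  try rewrite (x0 2 isT); try rewrite (x0 3 isT); try rewrite (x0 4 isT); ring.
Qed.

(** * Isomorphisms as changes of generators *)

(** The effect on structure constants, when c_12 = c_23 = 0, of the change of
    generators e_0 -> a e_0 + s e_1, e_1 -> b e_1.  Without denominators, the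
    equations are what comparing products gives directly. *)
Definition matches C C' (a b s : K) : Prop :=
  [/\ c11 C * a ^+ 5 = c11 C' * b,
      c14 C * a ^+ 4 = c14 C' * b,
      c13 C * a ^+ 3 = c13 C' * b,
      c01 C * a ^+ 5 = c01 C' * a + 2 * c11 C' * s
    & c00 C * (a ^+ 5 * b) =
        c00 C' * a ^+ 2 + c01 C' * (a * s) + c11 C' * s ^+ 2].

Lemma coefs_of_matches C C' a b s : a != 0 -> b != 0 -> matches C C' a b s ->
  [/\ c11 C = c11 C' * b / a ^+ 5,
      c14 C = c14 C' * b / a ^+ 4,
      c13 C = c13 C' * b / a ^+ 3,
      c01 C = (c01 C' * a + 2 * c11 C' * s) / a ^+ 5
    & c00 C = (c00 C' * a ^+ 2 + c01 C' * (a * s) + c11 C' * s ^+ 2)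
                / (a ^+ 5 * b)].
Proof.
move=> a0 b0 [E11 E14 E13 E01 E00].
by split; rewrite -(E11, E14, E13, E01, E00) mulfK // ?mulf_neq0 ?expf_neq0.
Qed.

(** The rows are the only possible images of the e_i under a homomorphism to
    L(C'), with c'_12 = c'_23 = 0, that maps e_0 to a e_0 + s e_1 and e_1 to
    b e_1: they are computed by e_(i+1) = [e_i, e_0]. *)
Definition change_mx C' (a b s : K) : 'M[K]_7 := \matrix_(i, j)
  nth 0 (nth [::] [::
   [:: a; s];
   [:: 0; b];
   [:: 0; 0; a * b; 0; 0; 0; c11 C' * s * b];
   [:: 0; 0; 0; a ^+ 2 * b; 0; - (a * b * s * c13 C'); - (a * b * s * c14 C')];
   [:: 0; 0; 0; 0; a ^+ 3 * b; 0; - (2 * s * a ^+ 2 * b * c13 C')];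
   [:: 0; 0; 0; 0; 0; a ^+ 4 * b];
   [:: 0; 0; 0; 0; 0; 0; a ^+ 5 * b]] i) j.

Lemma mul_change_mx C' a b s x k : (k < 7)%N ->
  crd (x *m change_mx C' a b s) k =
  let X i := crd x i in
  [:: a * X 0%N; s * X 0%N + b * X 1%N; a * b * X 2%N; a ^+ 2 * b * X 3%N;
      a ^+ 3 * b * X 4%N; a ^+ 4 * b * X 5%N - a * b * s * c13 C' * X 3%N;
      a ^+ 5 * b * X 6%N + c11 C' * s * b * X 2%N - a * b * s * c14 C' * X 3%N
        - 2 * s * a ^+ 2 * b * c13 C' * X 4%N]`_k.
Proof.
move=> lk; rewrite mxE.
under eq_bigr do rewrite -[X in x _ X]inord_val mxE inordK //.
do 7 rewrite ?big_ord_recl /=.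
rewrite big_ord0 /bump /= !add1n.
by case: k lk => [|[|[|[|[|[|[|k]]]]]]] lk //=; ring.
Qed.

Lemma change_mx_unit C' a b s :
  a != 0 -> b != 0 -> change_mx C' a b s \in unitmx.
Proof.
move=> a0 b0; rewrite -unitmx_tr unitmxE det_trig; last first.
  apply/is_trig_mxP => -[[|[|[|[|[|[|[|i]]]]]]] li] [[|[|[|[|[|[|[|j]]]]]]] lj];
    by rewrite !mxE.
rewrite unitfE; apply/prodf_neq0 => -[[|[|[|[|[|[|[|i]]]]]]] li] _ //;
  by rewrite !mxE /= ?mulf_neq0 ?expf_neq0.
Qed.

Lemma isomorphic_of_matches C C' a b s :
  c12 C = 0 -> c23 C = 0 -> c12 C' = 0 -> c23 C' = 0 ->
  a != 0 -> b != 0 -> matches C C' a b s -> isomorphic (L C) (L C').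
Proof.
move=> z12 z23 z12' z23' a0 b0 CC'.
have uP := change_mx_unit C' a b s a0 b0.
exists (mulmxr (change_mx C' a b s)); split.
  by exists (mulmxr (invmx (change_mx C' a b s))) => x /=;
    rewrite ?mulmxK ?mulmxKV.
have [D11 D14 D13 D01 D00] := coefs_of_matches C C' a b s a0 b0 CC'.
move=> x y; apply: rV7P => k lk.
rewrite /= mul_change_mx // L_crd //= !L_crd //= !mul_change_mx //=.
rewrite z12 z23 z12' z23' D11 D14 D13 D01 D00.
by case: k lk => [|[|[|[|[|[|[|k]]]]]]] lk //=; field; rewrite ?a0 ?b0.
Qed.

(** The entries of f that enter the argument are the diagonal ones, the
    coordinate s, and the superdiagonal from f e_2 on e_3 to f e_5 on e_6; the
    latter is needed to see that the equation for c_14 has no correction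
    term. *)
Lemma matches_of_isomorphic C C' :
  c12 C = 0 -> c23 C = 0 -> c12 C' = 0 -> c23 C' = 0 ->
  isomorphic (L C) (L C') ->
  exists a b s, [/\ a != 0, b != 0 & matches C C' a b s].
Proof.
move=> z12 z23 z12' z23' [f [/bij_inj f_inj f_mul]].
pose u i := f (e K i).
have F i j : (i < 7)%N -> (j < 7)%N -> L C' (u i) (u j) = f (table C i j).
  by move=> li lj; rewrite -L_basis // f_mul.
set p0 := crd (u 0) 0; set p1 := crd (u 0) 1.
set r0 := crd (u 1) 0; set r1 := crd (u 1) 1.
pose d := r1 * p0 - r0 * p1.
have b2 : below 2 (u 2).
  by move=> [|[|i]] // _; rewrite -[u 2]/(f (table C 1 0)) -F // L_crd.
have d2 : crd (u 2) 2 = d by rewrite -[u 2]/(f (table C 1 0)) -F // L_crd.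
have [b3 d3] : below 3 (u 3) /\ crd (u 3) 3 = d * p0.
  by rewrite -[u 3]/(f (table C 2 0)) -F // -d2; apply: L_below.
have [b4 d4] : below 4 (u 4) /\ crd (u 4) 4 = d * p0 ^+ 2.
  by rewrite -[u 4]/(f (table C 3 0)) -F // expr2 mulrA -d3; apply: L_below.
have [b5 d5] : below 5 (u 5) /\ crd (u 5) 5 = d * p0 ^+ 3.
  by rewrite -[u 5]/(f (table C 4 0)) -F // exprSr mulrA -d4; apply: L_below.
have [b6 d6] : below 6 (u 6) /\ crd (u 6) 6 = d * p0 ^+ 4.
  by rewrite -[u 6]/(f (table C 5 0)) -F // exprSr mulrA -d5; apply: L_below.
(* Otherwise f e_6 = 0, since f e_6 has no other coordinate. *)
have : d * p0 ^+ 4 != 0.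
  apply/eqP => d0; have /f_inj e60 : u 6 = f 0.
    rewrite raddf0; apply: rV7P => k; rewrite mxE ltnS leq_eqVlt.
    case/predU1P=> [->|].
      by rewrite d6.
    exact: b6.
  move/rowP/(_ (inord 6))/eqP: e60.
  by rewrite !mxE !eqxx oner_eq0.
rewrite mulf_eq0 expf_eq0 negb_or /= => /andP[d_neq0 p0_neq0].
have f12 : f (table C 1 2) = c13 C *: u 5 + c14 C *: u 6.
  by rewrite /table z12 scale0r add0r linearD !linearZ.
(* [f e_2, f e_1] has coordinate d r0 on e_3, while [e_2, e_1] lies in the
   span of e_5 and e_6. *)
have r0_eq0 : r0 = 0.
  have [_] := L_below C' 2 (u 2) (u 1) isT b2; rewrite F // d2.
  have -> : f (table C 2 1) = - (c13 C *: u 5 + c14 C *: u 6).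
    by rewrite -f12 -linearN.
  rewrite !mxE b5 // b6 // !mulr0 addr0 oppr0 => /esym/eqP.
  by rewrite mulf_eq0 (negPf d_neq0) => /eqP.
have dE : d = r1 * p0 by rewrite /d r0_eq0 mul0r subr0.
have r1_neq0 : r1 != 0.
  by apply: contraNneq d_neq0 => r10; rewrite dE r10 mul0r.
have E13 : c13 C * p0 ^+ 3 = c13 C' * r1.
  apply: (mulIf d_neq0).
  have := F 1 2 isT isT; rewrite f12 => /esym/rowP/(_ (inord 5)).
  rewrite L_crd //= !mxE d5 (b6 5) // d2 (b2 0) // (b2 1) //.
  rewrite z12' -/r0 r0_eq0 -/r1.
  by move=> E; ring: E.
(* The coordinate of f e_2 on e_3 propagates along the superdiagonal. *)
have s4 : crd (u 3) 4 = crd (u 2) 3 * p0.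
  rewrite -[u 3]/(f (table C 2 0)) -F // L_crd //= z12' (b2 0) //.
  by rewrite -/p0; ring.
have s5 : crd (u 4) 5 = crd (u 2) 3 * p0 ^+ 2.
  rewrite -[u 4]/(f (table C 3 0)) -F // L_crd //= z12'.
  by rewrite !(b3 0) // !(b3 1) // !(b3 2) // s4 -/p0; ring.
have s6 : crd (u 5) 6 = crd (u 2) 3 * p0 ^+ 3.
  rewrite -[u 5]/(f (table C 4 0)) -F // L_crd //= z12' z23'.
  rewrite !(b4 0) // !(b4 1) // !(b4 2) // !(b4 3) // s5 -/p0; ring.
exists p0, r1, p1; split=> //; split.
- have /esym/rowP/(_ (inord 6)) := F 1 1 isT isT; rewrite linearZ.
  rewrite L_crd //= !mxE d6 -/r0 r0_eq0 -/r1 z12' z23' dE => E.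
  apply: (mulIf r1_neq0).
  by ring: E.
- have /esym/rowP/(_ (inord 6)) := F 1 2 isT isT; rewrite f12.
  rewrite L_crd //= !mxE d6 s6 d2 -/r0 r0_eq0 -/r1 z12' z23'.
  rewrite (b2 0) // (b2 1) //.
  (* The terms in f e_5 on e_6 and f e_2 on e_3 cancel by E13. *)
  move=> /(canRL (addKr _)) E.
  apply: (mulIf d_neq0).
  by ring: E E13.
- exact: E13.
- (* Symmetrizing the product cancels every antisymmetric term. *)
  have : L C' (u 0) (u 1) + L C' (u 1) (u 0) = c01 C *: u 6.
    by rewrite !F //= linearD linearN linearZ addrAC addNr add0r.
  move/rowP/(_ (inord 6)); rewrite mxE !L_crd //= mxE d6.
  rewrite -/p0 -/p1 -/r0 r0_eq0 -/r1 z12' z23' dE => /esym E.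
  apply: (mulIf r1_neq0).
  by ring: E.
- have /esym/rowP/(_ (inord 6)) := F 0 0 isT isT; rewrite linearZ.
  rewrite L_crd //= !mxE d6 -/p0 -/p1 z12' z23' dE => E.
  by ring: E.
Qed.

(** * The two invariants *)

(** Minus the discriminant of the form q with [x, x] = q(x) e_6, times a factor
    whose weight compensates that of the discriminant. *)
Definition disc C := (c14 C / c11 C) ^+ 8 * (4 * c00 C * c11 C - c01 C ^+ 2).

Definition ratio C := c11 C * c13 C / c14 C ^+ 2.

Lemma invariants_of_matches C C' a b s : U13 C' ->
  a != 0 -> b != 0 -> matches C C' a b s ->
  disc C' = disc C /\ ratio C' = ratio C.
Proof.
move=> [_ _ x11 x14] a0 b0 CC'.
have [D11 D14 D13 D01 D00] := coefs_of_matches C C' a b s a0 b0 CC'.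
rewrite /disc /ratio D11 D14 D13 D01 D00.
by split; field; rewrite ?x11 ?x14 ?a0 ?b0.
Qed.

Lemma matches_of_invariants C C' : (2 : K) != 0 -> U13 C -> U13 C' ->
  disc C' = disc C -> ratio C' = ratio C ->
  exists a b s, [/\ a != 0, b != 0 & matches C C' a b s].
Proof.
move=> two0 [_ _ x11 x14] [_ _ y11 y14] Ed Er.
have four0 : (4 : K) != 0 by rewrite (natrM K 2 2) mulf_neq0.
have E13 : c13 C = ratio C' * c14 C ^+ 2 / c11 C.
  by rewrite Er /ratio; field; rewrite x11 x14.
have E00 : c00 C = (disc C' * (c11 C / c14 C) ^+ 8 + c01 C ^+ 2)
    / (4 * c11 C).
  by rewrite Ed /disc; field; rewrite x11 four0 x14.
(* Solve for a by dividing the equations for c_14 and c_11, then for b from that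
   for c_11 and for s from that for c_01. *)
pose a := c14 C * c11 C' / (c11 C * c14 C').
pose b := c11 C * a ^+ 5 / c11 C'.
pose s := (c01 C * a ^+ 5 - c01 C' * a) / (2 * c11 C').
have a0 : a != 0 by rewrite !(mulf_neq0, invr_neq0).
exists a, b, s; split=> //; first by rewrite !(mulf_neq0, expf_neq0, invr_neq0).
split; rewrite ?E13 ?E00 /disc /ratio /s /b /a; field;
  by rewrite ?two0 ?four0 ?x11 ?x14 ?y11 ?y14.
Qed.

Lemma isomorphicP C C' : (2 : K) != 0 -> U13 C -> U13 C' ->
  isomorphic (L C) (L C') <-> disc C' = disc C /\ ratio C' = ratio C.
Proof.
move=> two0 uC uC'; have [z23 z12 _ _] := uC; have [z23' z12' _ _] := uC'.
split=> [/matches_of_isomorphic[]// a [b [s [a0 b0 m]]] | [Ed Er]].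
  exact: invariants_of_matches m.
have [a [b [s [a0 b0 m]]]] := matches_of_invariants C C' two0 uC uC' Ed Er.
exact: isomorphic_of_matches m.
Qed.

End Classification.

Arguments disc {K}.
Arguments ratio {K}.

Theorem proposition2p9 (R : realType) :
  [/\ (* 1 *)
      forall C C' : params R[i], U13 C -> U13 C' ->
        (isomorphic (L C) (L C') <->
           (c14 C' / c11 C') ^+ 8 * (4 * c00 C' * c11 C' - c01 C' ^+ 2)
             = (c14 C / c11 C) ^+ 8 * (4 * c00 C * c11 C - c01 C ^+ 2)
           /\ c11 C' * c13 C' / c14 C' ^+ 2 = c11 C * c13 C / c14 C ^+ 2),
      (* 2 *)
      forall l1 l2 : R[i], exists C : params R[i],
        [/\ U13 C,
            (c14 C / c11 C) ^+ 8 * (4 * c00 C * c11 C - c01 C ^+ 2) = l1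
          & c11 C * c13 C / c14 C ^+ 2 = l2]
    & (* the orbits in U13 are parameterized by the L(l1, 0, 1, 0, l2, 1, 0) *)
      [/\ forall l1 l2 : R[i], U13 (Params l1 0 1 0 l2 1 0),
          forall C : params R[i], U13 C ->
            exists l1 l2 : R[i],
              isomorphic (L C) (L (Params l1 0 1 0 l2 1 0))
        & forall l1 l2 m1 m2 : R[i],
            isomorphic (L (Params l1 0 1 0 l2 1 0))
                       (L (Params m1 0 1 0 m2 1 0)) ->
            l1 = m1 /\ l2 = m2]].
Proof.
have two0 : (2 : R[i]) != 0 by rewrite pnatr_eq0.
have four0 : (4 : R[i]) != 0 by rewrite pnatr_eq0.
have U (l1 l2 : R[i]) : U13 (Params l1 0 1 0 l2 1 0).
  by split; rewrite //= oner_neq0.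
have dU (l1 l2 : R[i]) : disc (Params l1 0 1 0 l2 1 0) = 4 * l1.
  by rewrite /disc /=; field.
have rU (l1 l2 : R[i]) : ratio (Params l1 0 1 0 l2 1 0) = l2.
  by rewrite /ratio /=; field.
split; last split.
- by move=> C C' uC uC'; apply: isomorphicP.
- move=> l1 l2; exists (Params (l1 / 4) 0 1 0 l2 1 0); split=> //.
    by apply: etrans (dU (l1 / 4) l2) _; rewrite mulrC divfK.
  exact: rU.
- exact: U.
- move=> C uC; exists (disc C / 4), (ratio C).
  by apply/isomorphicP; rewrite // dU rU mulrC divfK.
- move=> l1 l2 m1 m2 /isomorphicP[]//; rewrite !dU !rU => /(mulfI four0) -> ->.
  by split.
Qed.
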